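(* Let $\mathbb{F}$ be a field of characteristic $2$ and let $P\in\mathbb{F}[x_1,\dots,x_m]$ be representable. Then for every $\ell=(\ell_1,\dots,\ell_m)\in\mathbb{F}^m$, the polynomial $P$ is factorizable modulo $\mathcal{I}(\ell^2)$, where $\ell^2=(\ell_1^2,\dots,\ell_m^2)$.
   Context: A polynomial $P\in\mathbb{F}[x_1,\dots,x_m]$ is called representable if there is a symmetric matrix $M$ whose entries all lie in $\mathbb{F}\cup\{x_1,\dots,x_m\}$ with $\det(M)=P$. For $\lambda=(\lambda_1,\dots,\lambda_m)\in\mathbb{F}^m$, let $\mathcal{I}(\lambda)=\langle x_1^2+\lambda_1,\dots,x_m^2+\lambda_m\rangle$, let $\mathcal{R}(\lambda)=\mathbb{F}[x_1,\dots,x_m]/\mathcal{I}(\lambda)$ and let $\pi_\lambda$ be the canonical projection. An element of $\mathcal{R}(\lambda)$ is linear if it is the projection of a polynomial of total degree at most $1$. A polynomial $P$ is factorizable modulo $\mathcal{I}(\lambda)$ if there are linear elements $t_1,\dots,t_k$ of $\mathcal{R}(\lambda)$ with $\pi_\lambda(P)=t_1\cdots t_k$. *)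

(* Defs.v *)
From HB Require Import structures.
From mathcomp Require Import all_boot all_order all_algebra ring_quotient.
From mathcomp Require Import boolp mpoly.

Set Implicit Arguments.
Unset Strict Implicit.
Unset Printing Implicit Defensive.

Import GRing.Theory.
Local Open Scope ring_scope.
Local Open Scope quotient_scope.

Definition representable (F : fieldType) (m : nat) (P : {mpoly F[m]}) : Prop :=
  exists (n : nat) (M : 'M[{mpoly F[m]}]_n),
    [/\ M^T = M,
        forall i j, (exists c : F, M i j = c%:MP) \/ (exists k : 'I_m, M i j = 'X_k)
      & \det M = P].

(* Used to see that the ideal below is proper over an arbitrary field. *)
Lemma add_square_roots (A : comNzRingType) (s : seq A) :
  exists (B : comNzRingType) (f : {rmorphism A -> B}),
    forall a, a \in s -> exists y : B, y ^+ 2 + f a = 0.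
Proof.
elim: s => [|a s [B [f fP]]]; first by exists A, idfun.
pose p : {poly B} := 'X^2 + (f a)%:P.
have ltC : (size (f a)%:P < size ('X^2 : {poly B}))%N.
  by rewrite size_polyXn (leq_ltn_trans (size_polyC_leq1 _)).
have sp : size p = 3 by rewrite size_polyDl // size_polyXn.
have mp : p \is monic by rewrite monicE lead_coefDl // lead_coefXn.
have pE : mk_monic p = p by rewrite /mk_monic sp mp.
pose g : {rmorphism A -> {poly %/ p}} :=
  GRing.RMorphism.clone _ _ (in_qpoly p \o polyC \o f) _.
exists {poly %/ p}, g => b; rewrite inE => /orP[/eqP ->|/fP [y yP]].
  exists (in_qpoly p 'X); rewrite /= -rmorphXn -rmorphD /=.
  by apply/val_inj; rewrite /= pE Pdiv.RingMonic.rmodpp.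
exists (in_qpoly p y%:P).
by rewrite /= -rmorphXn -rmorphXn -!rmorphD yP !rmorph0.
Qed.

Section Quotient.
Variables (F : fieldType) (m : nat) (lam : 'I_m -> F).

(* The ideal I(lam). Ideals of [ring_quotient] are boolean predicates, hence
   the use of [asbool]. *)
Definition sqideal (p : {mpoly F[m]}) : bool :=
  `[< exists h : 'I_m -> {mpoly F[m]},
        p = \sum_(i < m) h i * ('X_i ^+ 2 + (lam i)%:MP) >].

Fact sqideal_closed : idealr_closed sqideal.
Proof.
split.
- apply/asboolP; exists (fun=> 0).
  by rewrite big1 // => i _; rewrite mul0r.
- apply/asboolP => -[h hE].
  have [B [f fP]] := add_square_roots (codom lam).
  have /boolp.choice [y yP] : forall i, exists y : B, y ^+ 2 + f (lam i) = 0.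
    by move=> i; apply: fP; apply: codom_f.
  have /eqP := congr1 (mmap f y) hE.
  rewrite rmorph1 rmorph_sum big1 ?oner_eq0 // => i _.
  by rewrite rmorphM rmorphD rmorphXn /= mmapX mmap1U mmapC yP mulr0.
- move=> a p q /asboolP [h ->] /asboolP [k ->]; apply/asboolP.
  exists (fun i => a * h i + k i).
  rewrite mulr_sumr -big_split; apply: eq_bigr => i _.
  by rewrite mulrDl mulrA.
Qed.

HB.instance Definition _ := isIdealr.Build {mpoly F[m]} sqideal sqideal_closed.

Definition sqidealr : idealr {mpoly F[m]} := sqideal.

Definition sqquot : comNzRingType := {ideal_quot sqidealr}.

Definition sqproj (p : {mpoly F[m]}) : sqquot := \pi_({ideal_quot sqidealr}) p.

(* [msize q] is the total degree of [q] plus one, and 0 for [q = 0]. *)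
Definition is_linear (t : sqquot) : Prop :=
  exists q : {mpoly F[m]}, (msize q <= 2)%N /\ t = sqproj q.

Definition factorizable (P : {mpoly F[m]}) : Prop :=
  exists ts : seq sqquot,
    (forall t, t \in ts -> is_linear t) /\ sqproj P = \prod_(t <- ts) t.

End Quotient.

(* Main.v *)
(* In R(l^2) every square lies in F: r^2 = r(l)^2. Hence a linear r with
   r(l) <> 0 has the linear inverse r / r(l)^2, and a linear r with r(l) = 0
   has square zero. The image of M is a symmetric matrix with linear diagonal
   and arbitrary off-diagonal entries. In characteristic 2 a congruence
   B^T A' B of a symmetric matrix A' has diagonal entries sum_i A'_ii B_ik^2,
   which are linear when the diagonal of A' is. So symmetric elimination keeps
   the diagonal linear, both with an invertible diagonal pivot and with a 2x2
   pivot [[a, c], [c, b]], c invertible, a^2 = b^2 = 0, whose determinant is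
   a product of linear elements. When no entry is invertible, pairing each
   permutation with its inverse leaves only the product of the diagonal. *)
Require Import Defs.
From HB Require Import structures.
From mathcomp Require Import all_boot all_order all_fingroup all_algebra ring_quotient.
From mathcomp Require Import boolp mpoly ring.

Import GRing.Theory.
Local Open Scope ring_scope.

(** * Sums, quadratic forms and determinants in characteristic 2 *)

Section CharTwo.
Variables (R : comNzRingType) (addxx : forall x : R, x + x = 0).

Lemma opp_char2 (x : R) : - x = x.
Proof. by apply/eqP; rewrite eq_sym -addr_eq0 addxx. Qed.

(** Points moved by [g] come in pairs [x], [g x] with equal values, which cancel. *)
Lemma sum_involution_char2 (T : finType) (g : T -> T) (gK : involutive g)
    (f : T -> R) :
  (forall x, f (g x) = f x) -> \sum_x f x = \sum_(x | g x == x) f x.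
Proof.
move=> fg; rewrite (bigID (fun x => g x == x)) /=.
set S := (X in _ + X); suff -> : S = 0 by rewrite addr0.
(* [enum_rank] singles out one point of each pair; [g] carries the other half of the sum onto this
   one. *)
rewrite /S (bigID (fun x => enum_rank x < enum_rank (g x))%N) /=.
rewrite [X in _ + X](reindex_inj (inv_inj gK)) /=.
rewrite [X in _ + X](_ : _ = \sum_(x | (g x != x) &&
    (enum_rank x < enum_rank (g x))%N) f x) ?addxx //.
apply: eq_big => [x|x _]; last exact: fg.
rewrite gK eq_sym; case: eqVneq => //= gx.
rewrite -leqNgt ltn_neqAle; case: (_ <= _)%N; rewrite ?andbF ?andbT //.
apply/esym/negP => /eqP/val_inj/enum_rank_inj gxE.
by rewrite -gxE eqxx in gx.
Qed.

(** By symmetry of [S] the terms indexed by [(i, j)] and [(j, i)] agree, so only the fixed points of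
    this swap survive. *)
Lemma quad_form_char2 p q (S : 'M[R]_p) (B : 'M[R]_(p, q)) (k : 'I_q) :
  S^T = S -> (B^T *m S *m B) k k = \sum_i S i i * B i k ^+ 2.
Proof.
move=> symS; rewrite mxE.
under eq_bigr do rewrite !mxE mulr_suml.
rewrite pair_big /= (sum_involution_char2 _ (fun ij => (ij.2, ij.1))) /=.
- rewrite (reindex_onto (fun i => (i, i)) fst) /= => [|[i j] /= /eqP[_ ->]//].
  apply: eq_big => [i|i _]; first by rewrite !eqxx.
  by rewrite !mxE; ring.
- by case.
- move=> [i j] /=; rewrite !mxE -[in LHS]symS mxE; ring.
Qed.

Lemma det_char2_nilp_off_diag n (M : 'M[R]_n) :
  M^T = M -> (forall i j, i != j -> M i j ^+ 2 = 0) ->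
  \det M = \prod_i M i i.
Proof.
move=> symM offM.
have sgn (b : bool) : (-1) ^+ b = 1 :> R by case: b; rewrite ?expr1 ?opp_char2.
have -> : \det M = \sum_(s : 'S_n) \prod_i M i (s i).
  by apply: eq_bigr => s _; rewrite sgn mul1r.
rewrite (sum_involution_char2 _ (fun s : 'S_n => s^-1)%g).
- rewrite (bigD1 1%g) /=; last by rewrite invg1.
  rewrite [X in _ + X]big1 ?addr0 => [|s /andP[/eqP sV s1]].
    by apply: eq_bigr => i _; rewrite perm1.
  have [i si] : exists i, s i != i.
    apply/existsP; apply: contraR s1; rewrite negb_exists => /forallP sid.
    by apply/eqP/permP => i; rewrite perm1; apply/eqP; rewrite -[_ == _]negbK.
  (* A nontrivial involution [s] swaps some [i] and [s i]; by symmetry these two factors form the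
     square of an off-diagonal entry, hence 0. *)
  have ssi : s (s i) = i by rewrite -{1}sV permK.
  rewrite (bigD1 i) //= (bigD1 (s i)) //= ssi.
  by rewrite -[in X in _ * (X * _)]symM mxE mulrA -expr2 offM 1?eq_sym ?mul0r.
- exact: invgK.
- move=> s; rewrite (reindex_inj (@perm_inj _ s)) /=.
  by apply: eq_bigr => i _; rewrite permK -[in RHS]symM mxE.
Qed.

End CharTwo.

(** * Determinant identities used to bring a pivot to the front and eliminate it *)

Lemma det_perm_congr (R : comNzRingType) n (s : 'S_n) (M : 'M[R]_n) :
  \det (\matrix_(i, j) M (s i) (s j)) = \det M.
Proof.
have -> : \matrix_(i, j) M (s i) (s j) = perm_mx s *m M *m (perm_mx s)^T.
  rewrite tr_perm_mx -row_permE -col_permE.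
  by apply/matrixP => i j; rewrite !mxE ?invgK.
rewrite !det_mulmx mulrAC -det_mulmx tr_perm_mx -perm_mxM mulgV perm_mx1.
by rewrite det1 mul1r.
Qed.

Lemma det_mx22 (R : comNzRingType) (M : 'M[R]_2) :
  \det M = M 0 0 * M 1 1 - M 0 1 * M 1 0.
Proof.
rewrite (expand_det_row _ 0) !big_ord_recl big_ord0 addr0 /cofactor !det_mx11 !mxE /=.
have -> : lift ord0 ord0 = 1 :> 'I_2 by apply: val_inj.
have -> : lift 1 0 = 0 :> 'I_2 by apply: val_inj.
by rewrite addn0 expr0 expr1 mul1r mulN1r mulrN.
Qed.

Lemma det_schur (R : comNzRingType) p q (A A' : 'M[R]_p) (B : 'M[R]_(p, q))
    (C : 'M[R]_(q, p)) (D : 'M[R]_q) :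
  A *m A' = 1%:M ->
  \det (block_mx A B C D) = \det A * \det (D - C *m A' *m B).
Proof.
move=> AA'; have A'A := mulmx1C AA'.
have -> : block_mx A B C D =
    block_mx A 0 C 1%:M *m block_mx 1%:M (A' *m B) 0 (D - C *m A' *m B).
  rewrite mulmx_block !mulmx1 !mul0mx !mulmx0 !mul1mx !addr0.
  by rewrite !mulmxA AA' mul1mx addrC subrK.
by rewrite det_mulmx det_lblock det_ublock !det1 mulr1 mul1r.
Qed.

(** * Symmetric elimination in an abstract ring with constants and linear elements *)

Section LinearFactors.
(** [R] models the quotient ring, [iota] the embedding of constants, [rho] evaluation at the point
    [l], and [L] linearity. *)
Variables (F : fieldType) (R : comNzRingType) (iota : {rmorphism F -> R}).
Hypothesis charF : 2%N \in [pchar F].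
Variables (rho : R -> F).
Hypothesis sqrE : forall r, r ^+ 2 = iota (rho r) ^+ 2.
Variable L : R -> Prop.
Hypothesis LC : forall c, L (iota c).
Hypothesis LD : forall r s, L r -> L s -> L (r + s).
Hypothesis LZ : forall c r, L r -> L (iota c * r).

Definition splits (r : R) : Prop :=
  exists ts : seq R, (forall t, t \in ts -> L t) /\ r = \prod_(t <- ts) t.

Lemma splits1 : splits 1.
Proof. by exists [::]; rewrite big_nil. Qed.

Lemma splits_linear r : L r -> splits r.
Proof. by move=> Lr; exists [:: r]; rewrite big_seq1; split=> // t /[!inE] /eqP ->. Qed.

Lemma splitsM r s : splits r -> splits s -> splits (r * s).
Proof.
move=> [ts [tsL ->]] [us [usL ->]]; exists (ts ++ us); rewrite big_cat; split=> // t.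
by rewrite mem_cat => /orP[/tsL|/usL].
Qed.

Lemma addxx (x : R) : x + x = 0.
Proof.
by rewrite -mulr2n -mulr_natl -(rmorph_nat iota) (pcharf0 charF) rmorph0 mul0r.
Qed.

Lemma sqr_rho0 r : rho r = 0 -> r ^+ 2 = 0.
Proof. by move=> r0; rewrite sqrE r0 rmorph0 expr0n. Qed.

Lemma iotaV c : c != 0 -> iota c * iota c^-1 = 1.
Proof. by move=> c0; rewrite -rmorphM divff // rmorph1. Qed.

Lemma linear_sum (I : Type) (s : seq I) (f : I -> R) :
  (forall i, L (f i)) -> L (\sum_(i <- s) f i).
Proof.
move=> Lf; elim/big_ind: _ => //; by rewrite -(rmorph0 iota).
Qed.

(** The Schur complement is again symmetric. Its diagonal changes by a combination of the diagonal
    entries of [A'] whose coefficients are squares, hence constants, so it stays linear. *)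
Lemma splits_det_pivot p q (M : 'M[R]_(p + q)) (A' : 'M[R]_p) :
  M^T = M -> (forall i, L (M i i)) -> ulsubmx M *m A' = 1%:M ->
  A'^T = A' -> (forall i, L (A' i i)) -> splits (\det (ulsubmx M)) ->
  (forall N : 'M[R]_q, N^T = N -> (forall i, L (N i i)) -> splits (\det N)) ->
  splits (\det M).
Proof.
move=> symM LM AA' symA' LA' spA IH.
rewrite -[M]submxK (det_schur _ _ _ _ _ _ _ _ AA').
have -> : dlsubmx M = (ursubmx M)^T by rewrite trmx_ursub symM.
apply: splitsM => //; apply: IH => [|i].
  by rewrite linearB /= !trmx_mul trmxK symA' mulmxA trmx_drsub symM.
rewrite mxE [in X in _ + X]mxE (opp_char2 _ addxx) (quad_form_char2 _ addxx) //.
apply: LD; first by rewrite !mxE.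
by apply: linear_sum => j; rewrite sqrE mulrC -rmorphXn; apply: LZ.
Qed.

Lemma splits_det_pivot1 n (M : 'M[R]_(1 + n)) :
  M^T = M -> (forall i, L (M i i)) -> rho (M 0 0) != 0 ->
  (forall N : 'M[R]_n, N^T = N -> (forall i, L (N i i)) -> splits (\det N)) ->
  splits (\det M).
Proof.
move=> symM LM r0 IH.
have e0 : lshift n (0 : 'I_1) = 0 by apply: val_inj.
pose c := (rho (M 0 0) ^+ 2)^-1.
apply: (@splits_det_pivot 1 n M (iota c * M 0 0)%:M) => //.
- rewrite [ulsubmx M]mx11_scalar -scalar_mxM; congr _%:M.
  rewrite !mxE !e0 mulrCA -expr2 sqrE -rmorphXn mulrC iotaV //.
  by rewrite sqrf_eq0.
- exact: tr_scalar_mx.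
- by move=> i; rewrite ord1 mxE; apply: LZ.
- by rewrite det_mx11 !mxE e0; apply: splits_linear.
Qed.

(* Since [a ^+ 2 = b ^+ 2 = 0], the product [(s + a) (s + b) (s + a + b)] is
   [s * (a * b + s ^+ 2)]. *)
Lemma splits_nilp2 a b s : L a -> L b -> a ^+ 2 = 0 -> b ^+ 2 = 0 -> s != 0 ->
  splits (a * b + iota s ^+ 2).
Proof.
move=> La Lb a0 b0 s0.
have -> : a * b + iota s ^+ 2 = iota s^-1 *
    ((iota s + a) * ((iota s + b) * (iota s + a + b))).
  transitivity (iota s^-1 * (iota s * (a * b + iota s ^+ 2))).
    by rewrite mulrA (mulrC (iota _^-1)) iotaV // mul1r.
  congr (_ * _); set t := iota s.
  have -> : (t + a) * ((t + b) * (t + a + b)) = t * (a * b + t ^+ 2)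
     + t * (a ^+ 2 + b ^+ 2) + a ^+ 2 * b + a * b ^+ 2
     + (t ^+ 2 * (a + b) + t ^+ 2 * (a + b)) + (t * a * b + t * a * b) by ring.
  by rewrite !addxx a0 b0; ring.
apply: splitsM; first exact/splits_linear/LC.
by do !apply: splitsM; apply: splits_linear; do ?apply: LD.
Qed.

Lemma splits_det_pivot2 n (M : 'M[R]_(2 + n)) :
  M^T = M -> (forall i, L (M i i)) -> rho (M 0 0) = 0 -> rho (M 1 1) = 0 ->
  rho (M 0 1) != 0 ->
  (forall N : 'M[R]_n, N^T = N -> (forall i, L (N i i)) -> splits (\det N)) ->
  splits (\det M).
Proof.
move=> symM LM a0 b0 c0 IH.
pose a : R := M 0 0; pose b : R := M 1 1; pose c : R := M 0 1.
have ME : M 1 0 = c by rewrite -symM mxE.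
have e0 : lshift n (0 : 'I_2) = 0 by apply: val_inj.
have e1 : lshift n (1 : 'I_2) = 1 by apply: val_inj.
pose s := rho c ^+ 2; pose u := iota s^-1.
have s0 : s != 0 by rewrite sqrf_eq0.
have su : c ^+ 2 * u = 1 by rewrite sqrE -rmorphXn iotaV.
have aa : a ^+ 2 = 0 by apply: sqr_rho0.
have bb : b ^+ 2 = 0 by apply: sqr_rho0.
(* Here [u] is the inverse of [c ^+ 2]. Since [(a * b + c ^+ 2) ^+ 2 = c ^+ 4], the pivot
   determinant has inverse [(a * b + c ^+ 2) * u ^+ 2]. Multiplying the adjugate by it gives [d] off
   the diagonal and, as [a] and [b] square to 0, the linear entries [u * b] and [u * a] on it. *)
pose d := c * (a * b + c ^+ 2) * u ^+ 2.
pose A' := \matrix_(i < 2, j < 2)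
  if i == j then (if i == 0 then u * b else u * a) else d.
apply: (@splits_det_pivot 2 n M A') => //.
- have diagE : a * b * u + c * d = 1.
    transitivity (a * b * (u + (c ^+ 2 * u) * u) + (c ^+ 2 * u) ^+ 2).
      by rewrite /d; ring.
    by rewrite su mul1r addxx; ring.
  have offE1 : a * d + c * u * a = 0.
    transitivity (a ^+ 2 * b * c * u ^+ 2
      + a * c * u * (c ^+ 2 * u + 1)); first by rewrite /d; ring.
    by rewrite aa su addxx; ring.
  have offE2 : b * d + c * u * b = 0.
    transitivity (b ^+ 2 * a * c * u ^+ 2
      + b * c * u * (c ^+ 2 * u + 1)); first by rewrite /d; ring.
    by rewrite bb su addxx; ring.
  apply/matrixP => i j; rewrite !mxE !big_ord_recl big_ord0 !mxE /=.
  have o1 : lift ord0 ord0 = 1 :> 'I_2 by apply: val_inj.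
  rewrite !o1.
  have ord2 (k : 'I_2) : k = 0 \/ k = 1.
    by case: k => [[|[|//]] ?]; [left|right]; apply: val_inj.
  case: (ord2 i) => ->; case: (ord2 j) => ->;
    rewrite ?e0 ?e1 /= ?ME -/a -/b -/c.
  + by rewrite addr0 -[RHS]diagE; ring.
  + by rewrite addr0 -[RHS]offE1; ring.
  + by rewrite addr0 -[RHS]offE2; ring.
  + by rewrite addr0 -[RHS]diagE; ring.
- apply/matrixP => i j; rewrite !mxE eq_sym; by case: eqVneq => // ->.
- by move=> i; rewrite mxE eqxx; case: ifP => _; apply: LZ; apply: LM.
- rewrite det_mx22 !mxE !e0 !e1 ME -/a -/b -/c (opp_char2 _ addxx) -expr2 sqrE.
  by apply: splits_nilp2 => //; [exact: (LM 0)|exact: (LM 1)].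
Qed.

(** Strong induction on the size, since a pivot removes one or two rows. A diagonal pivot is sought
    first, so the 2x2 case may assume that [rho] vanishes on the diagonal. *)
Lemma splits_det n (M : 'M[R]_n) :
  M^T = M -> (forall i, L (M i i)) -> splits (\det M).
Proof.
elim/ltn_ind: n M => n IH M symM LM.
have permP (s : 'S_n) (N := \matrix_(i, j) M (s i) (s j)) :
    N^T = N /\ forall i, L (N i i).
  split=> [|i]; last by rewrite mxE.
  by apply/matrixP => i j; rewrite !mxE -[in LHS]symM mxE.
have [i iP|diag0] := pickP (fun i => rho (M i i) != 0).
  case: n => [|n] in M IH symM LM permP i iP *; first by case: i iP.
  pose s := tperm 0 i; rewrite -(det_perm_congr _ _ s).
  have [symN LN] := permP s.
  by apply: splits_det_pivot1 => // [|N]; [rewrite mxE tpermL|apply: IH].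
have [[i j] /= /andP[ij ijP]|off0] :=
    pickP (fun k : 'I_n * 'I_n => (k.1 != k.2) && (rho (M k.1 k.2) != 0)).
  case: n => [|[|n]] in M IH symM LM permP diag0 i j ij ijP *.
  - by case: i ij ijP.
  - by rewrite (ord1 i) (ord1 j) in ij.
  have [s [s0 s1]] : exists s : 'S_n.+2, s 0 = i /\ s 1 = j.
    (* The left factor acts first: it sends 1 to the preimage of [j] under [tperm 0 i], and it fixes
       0 because that preimage is not 0 when [i != j]. *)
    exists (tperm 1%R (tperm 0 i j) * tperm 0 i)%g.
    rewrite !permM tpermL tpermK; split=> //.
    rewrite [tperm 1 _ _]tpermD ?tpermL //.
    by apply: contra_neq ij => j0; rewrite -(tpermK 0 i j) j0 tpermL.
  rewrite -(det_perm_congr _ _ s).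
  have [symN LN] := permP s.
  apply: splits_det_pivot2 => //; rewrite ?mxE ?s0 ?s1 //.
  + by apply/eqP; rewrite -[_ == _]negbK diag0.
  + by apply/eqP; rewrite -[_ == _]negbK diag0.
  + by move=> N; apply: IH; rewrite ltnS leqnSn.
rewrite (det_char2_nilp_off_diag _ addxx) // => [|i j ij].
  by elim/big_ind: _ => // *; [exact: splits1|exact: splitsM|exact: splits_linear].
by apply: sqr_rho0; apply/eqP; have := off0 (i, j); rewrite /= ij => /negbFE.
Qed.

End LinearFactors.

(** * The quotient ring as an instance of the abstract setting *)

Section Quotient.
Variables (F : fieldType) (m : nat).

Section Projection.
Variable lam : 'I_m -> F.

Lemma sqproj_is_zmod_morphism : zmod_morphism (@sqproj F m lam).
Proof. exact: rmorphB. Qed.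

Lemma sqproj_is_monoid_morphism : monoid_morphism (@sqproj F m lam).
Proof. by split; [exact: rmorph1|exact: rmorphM]. Qed.

HB.instance Definition _ := GRing.isZmodMorphism.Build
  {mpoly F[m]} (sqquot lam) (@sqproj F m lam) sqproj_is_zmod_morphism.
HB.instance Definition _ := GRing.isMonoidMorphism.Build
  {mpoly F[m]} (sqquot lam) (@sqproj F m lam) sqproj_is_monoid_morphism.

Lemma sqprojK (r : sqquot lam) : sqproj lam (generic_quotient.repr r) = r.
Proof. exact: generic_quotient.reprK. Qed.

Lemma sqproj_sqrX i : sqproj lam 'X_i ^+ 2 = - sqproj lam (lam i)%:MP.
Proof.
rewrite -rmorphXn -rmorphN; apply/eqP.
rewrite /sqproj -Quotient.idealrBE opprK; apply/asboolP.
exists (fun j => (i == j)%:R); rewrite (bigD1 i) //= eqxx mul1r big1 ?addr0 //.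
by move=> j; rewrite eq_sym => /negPf ->; rewrite mul0r.
Qed.

End Projection.

Hypothesis charF : 2%N \in [pchar F].
Variable l : 'I_m -> F.
Local Notation pi := (sqproj (fun i => l i ^+ 2)).

Let iota : {rmorphism F -> sqquot (fun i => l i ^+ 2)} :=
  GRing.RMorphism.clone _ _ (pi \o @mpolyC m F) _.

(** Squaring is the Frobenius morphism, so it suffices to compare both sides on variables, where
    [x_i ^+ 2] becomes [- l i ^+ 2 = l i ^+ 2]. *)
Lemma sqproj_sqr p : pi p ^+ 2 = iota p.@[l] ^+ 2.
Proof.
have char2 : 2%N \in [pchar (sqquot (fun i => l i ^+ 2))].
  exact: (rmorph_pchar iota).
rewrite -!(pFrobenius_autE char2) {1}[p]mpolyE mevalE !rmorph_sum.
apply: eq_bigr => k _ /=; rewrite -mul_mpolyC !rmorphM; congr (_ * _).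
rewrite mpolyXE_id !rmorph_prod; apply: eq_bigr => i _.
rewrite !rmorphXn /= !pFrobenius_autE sqproj_sqrX (opp_char2 _ (addxx _ _ iota charF)).
by rewrite -(rmorphXn iota 2).
Qed.

Lemma sqproj_det_splits n (M : 'M[{mpoly F[m]}]_n) :
  M^T = M -> (forall i, (msize (M i i) <= 2)%N) ->
  factorizable (fun i => l i ^+ 2) (\det M).
Proof.
move=> symM szM; rewrite /factorizable -det_map_mx.
(* [rho] evaluates a chosen representative at [l]; [sqproj_sqr] provides the required identity
   between squares. *)
apply: (@splits_det F _ iota charF (fun r => (generic_quotient.repr r).@[l])).
- by move=> r; rewrite -sqproj_sqr sqprojK.
- by move=> c; exists c%:MP; rewrite msizeC; split=> //; case: (_ != _).
- move=> _ _ [p [sp ->]] [q [sq ->]]; exists (p + q); split; last by rewrite rmorphD.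
  by rewrite (leq_trans (msizeD_le _ _)) // geq_max sp.
- move=> c _ [p [sp ->]]; exists (c *: p); split; last by rewrite -mul_mpolyC rmorphM.
  exact: leq_trans (msizeZ_le _ _) sp.
- by rewrite map_trmx symM.
- by move=> i; exists (M i i); rewrite mxE.
Qed.

End Quotient.

Theorem theorem4p2 (F : fieldType) (charF : 2%N \in [pchar F]) (m : nat)
    (P : {mpoly F[m]}) (repP : representable P) (l : 'I_m -> F) :
  factorizable (fun i => l i ^+ 2) P.
Proof.
case: repP => n [M [symM entM <-]]; apply: sqproj_det_splits => // i.
by have [[c ->]|[k ->]] := entM i i; rewrite ?msizeC ?msizeX ?mdeg1 //; case: (_ != _).
Qed.
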